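(* Let $k\geq 2$ be fixed, and for $n\ge k$ let $\mathcal{X}_k$ be the complete $k$-uniform hypergraph on a set $X$ of $n$ variables, i.e. its edges are all the $m=\binom{n}{k}$ distinct $k$-subsets of $X$. Let $p(\mathcal{X}_k)$ be the probability that the randomly generated system over $\mathbb{F}_2$ associated with $\mathcal{X}_k$ is inconsistent. Then, as $n\to\infty$, $$p(\mathcal{X}_k)=1-\frac{2^{n}}{2^{\binom{n}{k}}}+O\left(\frac{n2^{n}}{2^{\binom{n}{k}+\binom{n-1}{k-1}}}\right).$$
   Context: A randomly generated system on a hypergraph $\mathcal{X}=(X,\{X_1,\ldots,X_m\})$, $|X|=n$, is a system $f_1(X_1)=0,\ldots,f_m(X_m)=0$ where the variable sets $X_i$ are fixed, and for each $i$ the polynomial $f_i$ is chosen independently and uniformly at random among all $2^{2^{|X_i|}}$ Boolean polynomials over $\mathbb{F}_2$ in the variables $X_i$ (equivalently, all functions $\mathbb{F}_2^{X_i}\to\mathbb{F}_2$). The system is inconsistent if no $a\in\mathbb{F}_2^n$ satisfies all equations. *)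

(* Defs.v *)
From HB Require Import structures.
From mathcomp Require Import all_boot all_order all_algebra.
Set Implicit Arguments.
Unset Strict Implicit.
Unset Printing Implicit Defensive.
Import Order.TTheory GRing.Theory Num.Theory.
Local Open Scope ring_scope.

(* A hypergraph on the variable set [X] is given by its set of edges
   [E : {set {set X}}]. *)

(* A Boolean polynomial in the variables [e], reduced modulo [x ^+ 2 = x], is
   the same thing as a function from F_2^e to F_2. *)
Definition boolean_poly (X : finType) (e : {set X}) :=
  {ffun {ffun {x : X | x \in e} -> 'F_2} -> 'F_2}.

Definition hsystem (X : finType) (E : {set {set X}}) :=
  {dffun forall e : {e : {set X} | e \in E}, boolean_poly (val e)}.

Definition restrict (X : finType) (e : {set X}) (a : {ffun X -> 'F_2}) :
    {ffun {x : X | x \in e} -> 'F_2} :=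
  [ffun x => a (val x)].

Definition solution (X : finType) (E : {set {set X}}) (f : hsystem E)
    (a : {ffun X -> 'F_2}) : bool :=
  [forall e : {e : {set X} | e \in E}, f e (restrict (val e) a) == 0].

Definition inconsistent (X : finType) (E : {set {set X}}) (f : hsystem E) :
    bool :=
  ~~ [exists a : {ffun X -> 'F_2}, solution f a].

Definition uniform_prob (R : numFieldType) (Omega : finType)
    (A : pred Omega) : R :=
  #|A|%:R / #|Omega|%:R.

(* Choosing the polynomials of the edges independently, each one uniformly, is
   choosing uniformly in their finite product [hsystem E]. *)
Definition prob_inconsistent (R : numFieldType) (X : finType)
    (E : {set {set X}}) : R :=
  uniform_prob R (@inconsistent X E).

Definition complete_uniform (n k : nat) : {set {set 'I_n}} :=
  [set e : {set 'I_n} | #|e| == k].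

(* Main.v *)
Require Import Defs.
From mathcomp Require Import all_boot all_order all_algebra.
From mathcomp Require Import zify.
Import Order.TTheory GRing.Theory Num.Theory.

(** Second-moment argument on the number N of solutions.  An assignment is a
    solution with probability 2^-m, so E N = 2^n / 2^m, and Bonferroni's
    inequalities bound the error |P(N = 0) - (1 - E N)| by the sum over ordered
    pairs a <> b of the probability that both are solutions.  That probability
    is 2^-(m + h), where h = C(n, k) - C(n - d, k) counts the edges meeting the
    set of the d coordinates where a and b differ.  For d = 1 there are n
    choices of b and h = C(n-1, k-1).  For d >= 2, h exceeds C(n-1, k-1) by at
    least C(n-2, k-1) >= n - k, so the at most 2^n choices of b together
    contribute at most 2^k 2^-(m + C(n-1, k-1)). *)

(** * Counting the systems solved by prescribed assignments *)

Lemma card_dffun_forall (I : finType) (T_ : I -> finType)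
    (P : forall i, pred (T_ i)) :
  #|[set f : {dffun forall i, T_ i} | [forall i, P i (f i)]]|
  = \prod_i #|P i|.
Proof.
(* The families counted are the elements of the product of the subtypes cut out by [P], embedded by
   [val]. *)
pose S_ i : finType := {x : T_ i | P i x}.
pose g (t : fprod S_) : {dffun forall i, T_ i} := [ffun i => val (t i)].
have g_inj : injective g.
  move=> t u /ffunP eq_tu; apply/fprodP => i; apply: val_inj.
  by have := eq_tu i; rewrite !ffunE.
transitivity #|fprod S_|; last first.
  by rewrite card_fprod; apply: eq_bigr => i _; rewrite card_sig.
rewrite -(card_imset predT g_inj); apply: eq_card => f.
rewrite inE; apply/forallP/imsetP => [Pf | [t _ ->] i]; last first.
  by rewrite ffunE; apply: valP.
exists [fprod i => (exist _ (f i) (Pf i) : S_ i)] => //.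
by apply/ffunP => i; rewrite ffunE fprodE.
Qed.

(** Vanishing on [S] leaves the values outside [S] free. The multiplicative form avoids division. *)
Lemma card_vanishing (U : finType) (S : {set U}) :
  (#|[pred g : {ffun U -> 'F_2} | [forall u in S, g u == 0%R]]| * 2 ^ #|S|
   = #|{ffun U -> 'F_2}|)%N.
Proof.
rewrite card_ffun card_Fp // -(cardC (mem S)) addnC expnD; congr (_ * _)%N.
have -> : (2 ^ #|[predC mem S]|)%N
    = #|pffun_on (0%R : 'F_2) [predC mem S] predT|.
  by rewrite card_pffun_on card_Fp.
apply: eq_card => g; rewrite !inE.
apply/forall_inP/pffun_onP => [g0 | [gS _] u uS].
  by split=> //; apply/subsetP => u; rewrite !inE; apply: contra => /g0.
apply/negPn/negP => gu; have := subsetP gS u.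
by rewrite !inE uS; move=> /(_ gu).
Qed.

(** The condition splits over the edges: [f e] must vanish at each restriction to [e] of a point of
    [S]. Points that agree on [e] impose a single condition, hence the cardinal of the image in the
    exponent. *)
Lemma card_common_solutions (X : finType) (E : {set {set X}})
    (S : {set {ffun X -> 'F_2}}) :
  (#|[set f : hsystem E | [forall a in S, solution f a]]|
    * 2 ^ (\sum_(e in E) #|restrict e @: S|) = #|hsystem E|)%N.
Proof.
have -> : #|[set f : hsystem E | [forall a in S, solution f a]]|
    = #|[set f : hsystem E | [forall e,
          [forall u in restrict (val e) @: S, f e u == 0%R]]]|.
  apply: eq_card => f; rewrite !inE.
  apply/forall_inP/forallP => [sol e | sol a aS].
    by apply/forall_inP => u /imsetP[a /sol /forallP/(_ e) ? ->].
  by apply/forallP => e; apply: (forall_inP (sol e)); apply: imset_f.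
pose B (e : {e : {set X} | e \in E}) : finType := boolean_poly (val e).
rewrite (card_dffun_forall _ B
  (fun e g => [forall u in restrict (val e) @: S, g u == 0%R])).
rewrite -[in RHS]cardsT.
have -> : [set: hsystem E] = [set f : hsystem E | [forall e, predT (f e)]].
  by apply/setP => f; rewrite !inE; symmetry; apply/forallP.
rewrite (card_dffun_forall _ B (fun=> predT)).
rewrite (big_sub (mem E)) expn_sum -big_split; apply: eq_bigr => e _ /=.
by rewrite -(card_vanishing _ (restrict (val e) @: S)).
Qed.

(** An edge sees two distinct restrictions exactly when it meets the set where [a] and [b] differ,
    and one otherwise. *)
Lemma sum_card_restrict_pair (X : finType) (E : {set {set X}})
    (a b : {ffun X -> 'F_2}) :
  (\sum_(e in E) #|restrict e @: [set a; b]|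
   = #|E| + #|[set e in E | ~~ [disjoint e & [set x | a x != b x]]]|)%N.
Proof.
rewrite -sum1_card -sum1dep_card big_mkcondr -big_split /=.
apply: eq_bigr => e _.
rewrite imsetU1 imset_set1 cards2 add1n; congr _.+1.
transitivity (nat_of_bool (~~ [disjoint e & [set x | a x != b x]]));
  last by case: (~~ _).
congr (nat_of_bool (~~ _)).
apply/eqP/pred0P => [/ffunP eq_ab x | eq_ab].
  rewrite /= !inE; apply/negP => /andP[xe /eqP]; apply.
  by have := eq_ab (exist _ x xe); rewrite !ffunE.
apply/ffunP => -[x xe]; rewrite !ffunE /=; apply/eqP.
by have := eq_ab x; rewrite /= !inE xe /= => /negbFE.
Qed.

(** The edges that miss [D] are the [k]-subsets of its complement. *)
Lemma card_complete_uniform_hit (n k : nat) (D : {set 'I_n}) :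
  (#|[set e in complete_uniform n k | ~~ [disjoint e & D]]| + 'C(n - #|D|, k)
   = 'C(n, k))%N.
Proof.
have <- : #|~: D| = (n - #|D|)%N.
  by apply: (canRL (addKn #|D|)); rewrite cardsC card_ord.
have <- : #|complete_uniform n k| = 'C(n, k) by rewrite card_draws card_ord.
rewrite -cards_draws.
set C := complete_uniform n k; pose B := [set e : {set 'I_n} | e \subset ~: D].
have -> : [set e : {set 'I_n} | e \subset ~: D & #|e| == k] = C :&: B.
  by apply/setP => e; rewrite !inE andbC.
have -> : [set e in C | ~~ [disjoint e & D]] = C :\: B.
  by apply/setP => e; rewrite !inE disjoints_subset andbC.
by rewrite addnC cardsID.
Qed.

(** * Bonferroni inequalities, in counting form *)

Lemma union_bound (Omega A : finType) (r : Omega -> A -> bool) :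
  (#|[set w | [exists a, r w a]]| <= \sum_a #|[set w | r w a]|)%N.
Proof.
under eq_bigr do rewrite -sum1dep_card big_mkcond.
rewrite -sum1dep_card big_mkcond exchange_big /=; apply: leq_sum => w _.
by case: existsP => // -[a rwa]; rewrite (bigD1 a) //= rwa.
Qed.

Lemma bonferroni_lower (Omega A : finType) (r : Omega -> A -> bool) :
  (\sum_a #|[set w | r w a]|
   <= #|[set w | [exists a, r w a]]|
      + \sum_a \sum_(b | b != a) #|[set w | r w a && r w b]|)%N.
Proof.
under eq_bigr do rewrite -sum1dep_card big_mkcond.
under [X in (_ <= _ + X)%N]eq_bigr => a _.
  under eq_bigr do rewrite -sum1dep_card big_mkcond.
  rewrite exchange_big; over.
rewrite -sum1dep_card (big_mkcond (fun w => [exists a, r w a])) exchange_big.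
rewrite [X in (_ <= _ + X)%N]exchange_big -big_split /=.
apply: leq_sum => w _; case: existsP => [[a rwa] | nr]; last first.
  by rewrite big1 // => a _; case: ifP => // rwa; case: nr; exists a.
(* For this [w], the witness [a] accounts for the 1, and every other [b] related to [w] is paid for
   by the ordered pair [(a, b)]. *)
rewrite (bigD1 a) //= rwa leq_add2l [leqRHS](bigD1 a) //=.
by apply: leq_trans (leq_addr _ _); apply: leq_sum => b _; rewrite rwa.
Qed.

Local Open Scope ring_scope.

(** * From counts to probabilities *)

Lemma uniform_prob_common_solutions (R : numFieldType) (X : finType)
    (E : {set {set X}}) (S : {set {ffun X -> 'F_2}}) :
  uniform_prob R [pred f : hsystem E | [forall a in S, solution f a]]
  = 2 ^- (\sum_(e in E) #|restrict e @: S|).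
Proof.
rewrite /uniform_prob -(card_common_solutions _ E S) natrM natrX cardsE.
rewrite invfM mulrA mulfV ?mul1r // pnatr_eq0 -lt0n.
(* Every assignment solves the zero system, so the count being cancelled is nonzero. *)
apply/card_gt0P; exists [ffun e => 0]; rewrite inE.
by apply/forall_inP => a _; apply/forallP => e; rewrite !ffunE.
Qed.

Lemma uniform_prob_solution (R : numFieldType) (X : finType)
    (E : {set {set X}}) (a : {ffun X -> 'F_2}) :
  uniform_prob R [pred f : hsystem E | solution f a] = 2 ^- #|E|.
Proof.
have -> : #|E| = (\sum_(e in E) #|restrict e @: [set a]|)%N.
  by rewrite -sum1_card; apply: eq_bigr => e _; rewrite imset_set1 cards1.
rewrite -uniform_prob_common_solutions; congr (_%:R / _); apply: eq_card => f.
by rewrite !inE; apply/idP/forall_inP => [sa b /set1P-> | ->] //; rewrite set11.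
Qed.

Lemma uniform_prob_solution_pair (R : numFieldType) (X : finType)
    (E : {set {set X}}) (a b : {ffun X -> 'F_2}) :
  uniform_prob R [pred f : hsystem E | solution f a && solution f b]
  = 2 ^- (#|E| + #|[set e in E | ~~ [disjoint e & [set x | a x != b x]]]|).
Proof.
rewrite -sum_card_restrict_pair -uniform_prob_common_solutions.
congr (_%:R / _); apply: eq_card => f; rewrite !inE.
apply/andP/forall_inP => [[sa sb] c /set2P[]-> // | sol].
by rewrite !sol // !inE eqxx ?orbT.
Qed.

Lemma prob_inconsistent_bound (R : numFieldType) (X : finType)
    (E : {set {set X}}) :
  `|prob_inconsistent R E - (1 - 2 ^+ #|X| / 2 ^+ #|E|)|
  <= \sum_(a : {ffun X -> 'F_2}) \sum_(b | b != a)
       2 ^- (#|E| + #|[set e in E | ~~ [disjoint e & [set x | a x != b x]]]|).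
Proof.
pose r (f : hsystem E) a := solution f a.
have := union_bound _ _ r; have := bonferroni_lower _ _ r.
set c := #|[set f | [exists a, r f a]]|; set s1 := (\sum_a #|_|)%N.
set s2 := (\sum_a \sum_(b | b != a) _)%N => s1_le c_le.
pose M : R := #|hsystem E|%:R.
have M_gt0 : 0 < M.
  by rewrite ltr0n; apply/card_gt0P; exists [ffun e => 0].
have -> : prob_inconsistent R E = 1 - c%:R / M.
  apply: (canRL (addrK _)); rewrite -mulrDl -natrD /c cardsE addnC.
  by rewrite -[X in (X + _)%N](@eq_card _
    [pred f : hsystem E | [exists a, r f a]]) // cardC divff ?gt_eqF.
have -> : 2 ^+ #|X| / 2 ^+ #|E| = s1%:R / M.
  rewrite natr_sum mulr_suml (eq_bigr (fun=> 2 ^- #|E|)) => [|a _].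
    by rewrite sumr_const card_ffun card_Fp // -[RHS]mulr_natl natrX.
  by rewrite -(uniform_prob_solution R _ E a) /uniform_prob cardsE.
rewrite (eq_bigr (fun a => \sum_(b | b != a)
    #|[set f | r f a && r f b]|%:R / M)) => [|a _]; last first.
  apply: eq_bigr => b _.
  by rewrite -uniform_prob_solution_pair /uniform_prob cardsE.
under eq_bigr do rewrite -mulr_suml -natr_sum.
rewrite -mulr_suml -natr_sum -/s2.
(* The union bound makes this difference nonnegative, which removes the absolute value;
   [bonferroni_lower] then bounds it by [s2 / M]. *)
have -> : 1 - c%:R / M - (1 - s1%:R / M) = (s1%:R - c%:R) / M.
  by rewrite opprB addrC subrKA mulrBl.
rewrite normrM [`|M^-1|]gtr0_norm ?invr_gt0 //.
rewrite ler_pM2r ?invr_gt0 // ger0_norm ?subr_ge0 ?ler_nat //.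
by rewrite lerBlDl -natrD ler_nat.
Qed.

(** * Estimating the sum over pairs by Hamming distance *)

Lemma card_hamming_sphere1 (X : finType) (a : {ffun X -> 'F_2}) :
  (#|[set b : {ffun X -> 'F_2} | #|[set x | a x != b x]| == 1%N]| <= #|X|)%N.
Proof.
(* In ['F_2], to differ is to differ by 1, so [flip] reaches every point at distance one. *)
pose flip x := [ffun y => if y == x then a y + 1 else a y].
apply: leq_trans (leq_imset_card flip predT); apply: subset_leq_card.
apply/subsetP => b; rewrite inE => /cards1P[x Dx]; apply/imsetP; exists x => //.
apply/ffunP => y; have /setP/(_ y) := Dx; rewrite !inE ffunE.
case: (y =P x) => [_ | _ /negbFE/eqP-> //].
by case: (a y) (b y) => [[|[|?]] ?] [[|[|?]] ?] //= _; apply: val_inj.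
Qed.

(** By Pascal's rule, raising [n] by one adds a positive binomial as long as the lower index fits;
    otherwise the summand [k] alone suffices. *)
Lemma leq_bin_lin (n k : nat) : (0 < k)%N -> (n < 'C(n, k) + k)%N.
Proof.
elim: n k => [|n IHn] [|k] // _.
by rewrite binS; have := IHn k.+1 isT; have := bin_gt0 n k; lia.
Qed.

Lemma sum_pair_solution_bound (R : numFieldType) (n k : nat)
    (a : {ffun 'I_n -> 'F_2}) :
  (2 <= k)%N -> (k <= n)%N ->
  \sum_(b | b != a)
    2 ^- ('C(n, k) + #|[set e in complete_uniform n k |
                         ~~ [disjoint e & [set x | a x != b x]]]|)
  <= (n + 2 ^ k)%:R / 2 ^+ ('C(n, k) + 'C(n.-1, k.-1)) :> R.
Proof.
move=> k_ge2 le_kn; pose D (b : {ffun 'I_n -> 'F_2}) := [set x | a x != b x].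
pose h b := #|[set e in complete_uniform n k | ~~ [disjoint e & D b]]|.
have D_gt0 b : b != a -> (0 < #|D b|)%N.
  rewrite card_gt0; apply: contra => /eqP/setP D0; apply/eqP/ffunP => x.
  by have := D0 x; rewrite !inE => /negbFE/eqP.
have pascal m : (0 < m)%N -> ('C(m, k) = 'C(m.-1, k) + 'C(m.-1, k.-1))%N.
  by case: m (k) k_ge2 => [|m] [|k'] //= _ _; rewrite binS.
have n_ge2 := leq_trans k_ge2 le_kn.
have h1 b : #|D b| = 1%N -> h b = 'C(n.-1, k.-1).
  move=> Db; have := card_complete_uniform_hit n k (D b).
  rewrite -/(h b) Db subn1 (pascal n) ?(ltnW n_ge2) //; lia.
(* By monotonicity distance two is the worst case. Two Pascal steps then leave the surplus
   ['C(n.-2, k.-1)], which is at least [n - k]. *)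
have h2 b : (1 < #|D b|)%N -> ('C(n.-1, k.-1) + n <= h b + k)%N.
  move=> Db; have := card_complete_uniform_hit n k (D b); rewrite -/(h b).
  have : ('C(n - #|D b|, k) <= 'C(n.-2, k))%N by apply: leq_bin2l; lia.
  have n1_gt0 : (0 < n.-1)%N by lia.
  have := pascal n (ltnW n_ge2); have := pascal n.-1 n1_gt0.
  have : (n <= 'C(n.-2, k.-1) + k)%N.
    have k1_gt0 : (0 < k.-1)%N by lia.
    have := leq_bin_lin n.-2 k.-1 k1_gt0; lia.
  move: (h b) 'C(n, k) 'C(n.-1, k) 'C(n.-1, k.-1) 'C(n.-2, k) 'C(n.-2, k.-1).
  move: 'C(n - _, k); lia.
rewrite (bigID (fun b => #|D b| == 1%N)) /= natrD mulrDl; apply: lerD.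
  rewrite (eq_bigr (fun=> 2 ^- ('C(n, k) + 'C(n.-1, k.-1)))); last first.
    by move=> b /andP[_ /eqP/h1 <-].
  rewrite sumr_const -[leLHS]mulr_natl ler_wpM2r ?invr_ge0 ?exprn_ge0 //.
  rewrite ler_nat -[leqRHS]card_ord; apply: leq_trans (card_hamming_sphere1 _ a).
  by apply: subset_leq_card; apply/subsetP => b; rewrite !inE => /andP[].
(* By [h2] each remaining term is at most this summand. Extending the sum to all [2 ^ n] assignments
   cancels the factor [2 ^+ n] and leaves [2 ^ k]. *)
apply: (@le_trans _ _ (\sum_(b : {ffun 'I_n -> 'F_2}) (2 ^ k)%:R /
  (2 ^+ n * 2 ^+ ('C(n, k) + 'C(n.-1, k.-1))))).
  rewrite [leRHS](bigID (fun b => (b != a) && (#|D b| != 1%N))) /=.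
  rewrite -[leLHS]addr0; apply: lerD; last first.
    by apply: sumr_ge0 => b _; rewrite divr_ge0 ?mulr_ge0 ?exprn_ge0.
  apply: ler_sum => b /andP[ba Db].
  rewrite ler_pdivlMr ?mulr_gt0 ?exprn_gt0 // mulrC ler_pdivrMr ?exprn_gt0 //.
  rewrite natrX -!exprD ler_eXn2l ?ltr1n //.
  have {}/h2 : (1 < #|D b|)%N by rewrite ltn_neqAle eq_sym Db D_gt0.
  rewrite -/(h b); move: (h b) 'C(n, k) 'C(n.-1, k.-1); lia.
rewrite sumr_const card_ffun card_Fp // card_ord -[leLHS]mulr_natl.
by rewrite invfM (mulrCA (2 ^ k)%:R) -natrX mulVKf // pnatr_eq0 expn_eq0.
Qed.

Lemma prob_inconsistent_complete_uniform (R : numFieldType) (n k : nat) :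
  (2 <= k)%N -> (k <= n)%N ->
  `|prob_inconsistent R (complete_uniform n k) - (1 - 2 ^+ n / 2 ^+ 'C(n, k))|
  <= (n + 2 ^ k)%:R * 2 ^+ n / 2 ^+ ('C(n, k) + 'C(n.-1, k.-1)).
Proof.
move=> k_ge2 le_kn.
have card_E : #|complete_uniform n k| = 'C(n, k) by rewrite card_draws card_ord.
have := prob_inconsistent_bound R _ (complete_uniform n k).
rewrite card_E card_ord => /le_trans; apply.
apply: le_trans
  (ler_sum _ (fun a _ => sum_pair_solution_bound R n k a k_ge2 le_kn)) _.
by rewrite sumr_const card_ffun card_Fp // card_ord -[leLHS]mulr_natl natrX mulrA
  (mulrC (2 ^+ n)).
Qed.

(* Required only here: [all_analysis] has its own [restrict] and
   [uniform_prob], which would shadow those of [Defs]. *)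
From mathcomp Require Import all_classical all_reals all_analysis.
Import numFieldNormedType.Exports.
Local Open Scope classical_set_scope.

Theorem theorem8 (R : realType) (k : nat) (hk : (2 <= k)%N) :
  (fun n : nat => prob_inconsistent R (complete_uniform n k) : R) =
  (fun n : nat => 1 - 2 ^+ n / 2 ^+ 'C(n, k) : R)
  +O_ \oo (fun n : nat =>
    n%:R * 2 ^+ n / 2 ^+ ('C(n, k) + 'C(n.-1, k.-1))%N : R).
Proof.
(* This constant works because [n + 2 ^ k <= (1 + 2 ^ k) * n] as soon as [n] is positive. *)
apply/eqaddOP; apply/bigO_exP; exists (1 + 2 ^+ k) => /=.
  by rewrite ltr_wpDr ?exprn_ge0.
near=> n.
have le_kn : (k <= n)%N by near: n; exact: nbhs_infty_ge.
have n_gt0 : (0 < n)%N := leq_trans (ltnW hk) le_kn.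
rewrite -[X in `|X|]/(prob_inconsistent R (complete_uniform n k)
  - (1 - 2 ^+ n / 2 ^+ 'C(n, k))).
apply: le_trans (prob_inconsistent_complete_uniform R n k hk le_kn) _.
rewrite ger0_norm ?divr_ge0 ?mulr_ge0 ?exprn_ge0 //.
rewrite !mulrA ler_wpM2r ?invr_ge0 ?exprn_ge0 // ler_wpM2r ?exprn_ge0 //.
rewrite natrD natrX mulrDl mul1r lerD2l ler_peMr ?exprn_ge0 //.
by rewrite ler1n.
Unshelve. all: by end_near.
Qed.
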